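(* Let $q$ be a prime power, $k\ge 1$, and let $\mathfrak m$ be a $k$-tuple of nonnegative integers with $\mathfrak m>\mathfrak 0$. Then $$I_k(\mathfrak m)=N_k(\mathfrak m)-\sum_{(a_{\mathfrak i})}\ \prod_{\mathfrak 0<\mathfrak i<\mathfrak m}\binom{I_k(\mathfrak i)+a_{\mathfrak i}-1}{a_{\mathfrak i}},$$ where the sum is over all families $(a_{\mathfrak i})_{\mathfrak 0<\mathfrak i<\mathfrak m}$ of nonnegative integers with $\sum_{\mathfrak i}a_{\mathfrak i}\mathfrak i=\mathfrak m$. Together with $I_k(\mathfrak 0)=0$ this determines $I_k(\mathfrak m)$ recursively.
   Context: $\mathbb F_q$ is the finite field with $q$ elements. Two polynomials in $\mathbb F_q[x_1,\dots,x_k]$ are identified if they differ by a factor in $\mathbb F_q^\times$; the classes are called normalized polynomials. The vector degree of a nonzero $f$ is $\operatorname{Deg} f=(\deg_{x_1}f,\dots,\deg_{x_k}f)$. $k$-tuples of nonnegative integers are ordered componentwise, $\mathfrak 0$ is the zero tuple, and $\mathfrak a<\mathfrak b$ means $\mathfrak a\le\mathfrak b$ and $\mathfrak a\ne\mathfrak b$. $N_k(\mathfrak m)$ is the number of normalized polynomials $f\in\mathbb F_q[x_1,\dots,x_k]$ with $\operatorname{Deg} f=\mathfrak m$, and $I_k(\mathfrak m)$ is the number of those that are irreducible. $\binom{I+a-1}{a}$ is the number of multisets of size $a$ from a set of size $I$ (so it equals $1$ if $a=0$, and $0$ if $I=0<a$). *)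

(* Defs.v *)
From HB Require Import structures.
From mathcomp Require Import all_boot all_order all_algebra finmap.
From mathcomp Require Import mpoly.
From mathcomp Require Import boolp classical_sets functions cardinality fsbigop.

Set Implicit Arguments.
Unset Strict Implicit.
Unset Printing Implicit Defensive.

Import GRing.Theory.

Local Open Scope classical_set_scope.
Local Open Scope ring_scope.

(* Tuples of nonnegative integers are elements of 'X_{1..k}. The relations    *)
(* (a <= b)%MM and (a < b)%MM are the componentwise order and its strict part *)
(* (a <= b and a != b); they are not the monomial order (a <= b)%O.           *)

Section Counting.
Variables (F : finFieldType) (k : nat).
Implicit Types (f g h : {mpoly F[k]}) (m : 'X_{1..k}).

(* Only meaningful for f != 0: the zero polynomial has empty support and gets *)
(* vector degree 0.                                                           *)
Definition vdeg f : 'X_{1..k} :=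
  [multinom \max_(e <- msupp f) e i | i < k].

Definition mpoly_irreducible f : Prop :=
  [/\ f != 0, f \isn't a GRing.unit
    & forall g h, f = g * h -> g \is a GRing.unit \/ h \is a GRing.unit].

Definition normalized f : set {mpoly F[k]} :=
  [set g | exists2 c : F, c != 0 & g = c *: f].

Definition normalized_of_vdeg m : set (set {mpoly F[k]}) :=
  normalized @` [set f | f != 0 /\ vdeg f = m].

(* Vector degree and irreducibility do not depend on the representative.      *)
Definition normalized_irreducible_of_vdeg m : set (set {mpoly F[k]}) :=
  normalized @` [set f | mpoly_irreducible f /\ vdeg f = m].

(* fset_set A is A as a finite set when A is finite, which is proved below in *)
(* both cases.                                                                *)
Definition Nk m : nat := #|` fset_set (normalized_of_vdeg m)|.
Definition Ik m : nat := #|` fset_set (normalized_irreducible_of_vdeg m)|.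

Lemma finite_vdeg m : finite_set [set f | vdeg f = m].
Proof.
pose b := (mdeg m).+1.
pose P (a : {ffun 'X_{1..k < b} -> F}) : {mpoly F[k]} :=
  \sum_(e : 'X_{1..k < b}) a e *: 'X_[e].
apply: (sub_finite_set (B := P @` setT)); last exact/finite_image/finite_finset.
move=> f /= fm; exists [ffun e : 'X_{1..k < b} => f@_e] => //.
have szf : (msize f <= b)%N.
  rewrite msizeE; apply/bigmax_leqP_seq => e ef _.
  rewrite ltnS !mdegE; apply: leq_sum => i _.
  by rewrite -fm mnmE; exact: (leq_bigmax_seq e ef).
by rewrite [RHS](mpolywE szf); apply: eq_bigr => e _; rewrite ffunE.
Qed.

Lemma finite_normalized_of_vdeg m : finite_set (normalized_of_vdeg m).
Proof.
by apply: finite_image; apply: sub_finite_set (finite_vdeg m) => f [].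
Qed.

Lemma finite_normalized_irreducible_of_vdeg m :
  finite_set (normalized_irreducible_of_vdeg m).
Proof.
by apply: finite_image; apply: sub_finite_set (finite_vdeg m) => f [].
Qed.

End Counting.

Section Recursion.
Variable k : nat.
Implicit Types m : 'X_{1..k}.

(* The index set of all tuples i with 0 < i < m. The bound mdeg i < mdeg m,   *)
(* which i < m implies (ltm_mdeg below), only serves to make the type finite. *)
Definition between0 m : Type :=
  {i : 'X_{1..k < mdeg m} | (0 < i)%MM && (i < m)%MM}.

HB.instance Definition _ m := Finite.on (between0 m).

Definition tuple_of m (i : between0 m) : 'X_{1..k} := bmnm (val i).

Definition families m : set {ffun between0 m -> nat} :=
  [set a | (\sum_(i : between0 m) tuple_of i *+ a i)%MM = m].
Arguments families : clear implicits.

(* The truncated subtraction is harmless: for J i = a i = 0 it gives          *)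
(* 'C(0, 0) = 1.                                                              *)
Definition reducible_sum (J : 'X_{1..k} -> nat) m : int :=
  \sum_(a \in families m)
    (\prod_(i : between0 m) 'C(J (tuple_of i) + a i - 1, a i))%N%:Z.

Lemma ltm_mdeg (i m : 'X_{1..k}) : (i < m)%MM -> (mdeg i < mdeg m)%N.
Proof.
case/andP => ne le; rewrite -(submK le) mdegD -[X in (X < _)%N]add0n ltn_add2r.
rewrite lt0n mdeg_eq0; apply: contra ne => /eqP e.
by rewrite -[m](submK le) e add0m.
Qed.

Lemma between0P m (i : 'X_{1..k}) :
  reflect (exists j : between0 m, tuple_of j = i) ((0 < i)%MM && (i < m)%MM).
Proof.
apply: (iffP idP) => [im|[[j jm] <-] //].
have lt_im : (mdeg i < mdeg m)%N by case/andP: im => _ /ltm_mdeg.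
by exists (exist _ (BMultinom lt_im) im).
Qed.

Lemma finite_families m : finite_set (families m).
Proof.
pose g (b : {ffun between0 m -> 'I_(mdeg m).+1}) : {ffun between0 m -> nat} :=
  [ffun i => b i : nat].
apply: (sub_finite_set (B := g @` setT)); last exact/finite_image/finite_finset.
move=> a /= am; exists [ffun i => inord (a i)] => //.
apply/ffunP => i; rewrite !ffunE inordK // ltnS.
have := congr1 (@mdeg k) am; rewrite mdeg_sum => <-.
rewrite (bigD1 i) //= mdegMn; apply: leq_trans (leq_addr _ _).
rewrite leq_pmull // lt0n mdeg_eq0 eq_sym.
by case/andP: (valP i) => /andP[].
Qed.

End Recursion.

(* Main.v *)
Require Import Defs.
From mathcomp Require Import all_boot all_order all_algebra finmap.
From mathcomp Require Import mpoly.
From mathcomp Require Import ring zify.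
From mathcomp Require Import boolp classical_sets cardinality fsbigop.

Set Implicit Arguments.
Unset Strict Implicit.
Unset Printing Implicit Defensive.

Import GRing.Theory.

Local Open Scope ring_scope.

(* F[x_1..x_k] has unique factorization (Gauss) and Deg is additive on        *)
(* products. Hence, for m > 0, a normalized polynomial of vector degree m is  *)
(* the same as a multiset of normalized irreducibles whose vector degrees add *)
(* up to m. The irreducible polynomials are the one-element multisets; in all *)
(* the others every factor has a degree i with 0 < i < m, and sorting the     *)
(* factors by degree, with a_i factors of degree i, gives the product of      *)
(* binomials.                                                                 *)

(** Two algebraic facts carry the count. Irreducibles of F[x_1..x_k] are prime:
    [irreducible_prime_poly] passes this from a factorial domain to univariate polynomials over it,
    and [mpoly_irreducible_prime] iterates it over the variables. Vector degrees add ([vdegM]). Each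
    normalized class has exactly one monic member, so monic polynomials are counted. The reducible
    ones of degree m > 0 correspond to exponent functions on the finite set of monic irreducibles of
    degree < m. Let a_i be the total multiplicity in degree i; the functions with given (a_i) are
    independent choices of one multiset per degree ([card_graded_multiset]), and summing over (a_i)
    gives [card_monic_reducible]. The sum involves I_k only below m, whence uniqueness by induction
    on the total degree. *)

Section Divisibility.
Variable R : idomainType.
Implicit Types a b c p q : R.

Definition divides a b : Prop := exists c, b = a * c.

Definition irreducible_elt p : Prop :=
  [/\ p != 0, p \isn't a GRing.unit
    & forall a b, p = a * b -> a \is a GRing.unit \/ b \is a GRing.unit].

Definition prime_elt p : Prop :=
  [/\ p != 0, p \isn't a GRing.unit
    & forall a b, divides p (a * b) -> divides p a \/ divides p b].

Lemma divides_mulr p a b : divides p a -> divides p (a * b).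
Proof. by case=> c ->; exists (c * b); rewrite mulrA. Qed.

Lemma divides_mull p a b : divides p b -> divides p (a * b).
Proof. by rewrite mulrC; apply: divides_mulr. Qed.

Lemma divides_add p a b : divides p a -> divides p b -> divides p (a + b).
Proof. by case=> c -> [d ->]; exists (c + d); rewrite mulrDr. Qed.

Lemma prime_divides_prod (I : Type) (r : seq I) (P : pred I) (f : I -> R) p :
  prime_elt p -> divides p (\prod_(i <- r | P i) f i) ->
  exists2 i, P i & divides p (f i).
Proof.
case=> _ pU pP; elim: r => [|i r IH].
  rewrite big_nil => -[c e]; case/negP: pU.
  by apply/unitrPr; exists c.
rewrite big_cons; case: ifP => Pi; last exact: IH.
by case/pP => [|/IH//]; exists i.
Qed.

Lemma prime_divides_exp p a n :
  prime_elt p -> divides p (a ^+ n) -> divides p a.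
Proof.
by move=> pp; rewrite -[n]card_ord -prodr_const => /(prime_divides_prod pp)[].
Qed.

(** Uniqueness of factorization is encoded as irreducibles being prime, the form that passes to
    polynomial rings. *)
Definition factorial_ring : Prop :=
  (forall p, irreducible_elt p -> prime_elt p) /\
  (forall a, a != 0 -> exists u (s : seq R),
    [/\ u \is a GRing.unit, forall p, p \in s -> irreducible_elt p
      & a = u * \prod_(p <- s) p]).

End Divisibility.

(** * Gauss: univariate polynomials over a factorial domain *)

Section Gauss.
Variable R : idomainType.
Implicit Types (c e p : R) (f g h : {poly R}).

Lemma divides_polyC_cons p f c :
  divides p%:P (f * 'X + c%:P) <-> divides p%:P f /\ divides p c.
Proof.
split=> [[g e]|[[g ->] [d ->]]]; last first.
  by exists (g * 'X + d%:P); rewrite mulrDr mulrA polyCM.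
split; last first.
  exists g`_0; have := congr1 (fun h : {poly R} => h`_0) e.
  by rewrite coefD coefMX coefC /= add0r coefCM.
exists (\poly_(i < size g) g`_i.+1); apply/polyP=> i.
have := congr1 (fun h : {poly R} => h`_i.+1) e.
rewrite coefD coefMX coefC /= addr0 !coefCM coef_poly => ->.
by case: ltnP => // le; rewrite nth_default ?mulr0 // ltnW.
Qed.

(** Gauss's lemma, by induction on the sum of the sizes. As p divides the product of the constant
    terms of f and g, it divides one of them; removing that term and a factor X leaves a smaller
    product still divisible by p. *)
Lemma prime_polyC p : prime_elt p -> prime_elt p%:P.
Proof.
case=> p0 pU pP; split=> [||f g].
- by rewrite polyC_eq0.
- by rewrite poly_unitE coefC negb_and eqxx pU orbT.
move: {2}(size f + size g)%N (leqnn (size f + size g)) => n.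
elim: n f g => [|n IH] f g.
  rewrite leqn0 addn_eq0 size_poly_eq0 => /andP[/eqP-> _] _.
  by left; exists 0; rewrite mulr0.
have divides_shift h : divides p%:P (h * 'X) -> divides p%:P h.
  by rewrite -[h * 'X]addr0 -polyC0 => /divides_polyC_cons[].
have split0 h : h != 0 -> exists h' c, [/\ h = h' * 'X + c%:P & (size h' < size h)%N].
  move=> h0; exists (\poly_(i < (size h).-1) h`_i.+1), h`_0; split.
    apply/polyP=> -[|i]; rewrite coefD coefMX coefC /= ?add0r // addr0 coef_poly.
    case: ltnP => // le; rewrite nth_default // -(prednK (n := size h)) //.
    by rewrite lt0n size_poly_eq0.
  by rewrite (leq_ltn_trans (size_poly _ _)) // prednK // lt0n size_poly_eq0.
have [->|f0] := eqVneq f 0; first by left; exists 0; rewrite mulr0.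
have [->|g0] := eqVneq g 0; first by right; exists 0; rewrite mulr0.
have [f' [a [ef sf]]] := split0 _ f0; have [g' [b [eg sg]]] := split0 _ g0.
move=> le dfg.
have dab : divides p (a * b).
  have : divides p%:P ((f' * g + g' * a%:P) * 'X + (a * b)%:P).
    suff -> : (f' * g + g' * a%:P) * 'X + (a * b)%:P = f * g by [].
    by rewrite polyCM; ring: ef eg.
  by case/divides_polyC_cons.
case: (pP _ _ dab) => [da|db].
  have d' : divides p%:P (f' * g).
    apply: divides_shift; rewrite mulrAC.
    have -> : f' * 'X * g = f * g + - (a%:P * g) by rewrite [in RHS]ef mulrDl addrK.
    apply: divides_add dfg _; case: da => d ->.
    by exists (- (d%:P * g)); rewrite polyCM mulrN mulrA.
  case: (IH f' g _ d') => [|df'|]; [|left|by right].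
    by rewrite -ltnS (leq_trans _ le) // ltn_add2r.
  by rewrite ef; apply/divides_polyC_cons.
have d' : divides p%:P (f * g').
  apply: divides_shift; rewrite -mulrA.
  have -> : f * (g' * 'X) = f * g + - (f * b%:P) by rewrite [in RHS]eg mulrDr addrK.
  apply: divides_add dfg _; case: db => d ->.
  by exists (- (f * d%:P)); rewrite polyCM mulrN mulrCA.
case: (IH f g' _ d') => [||dg']; [|by left|right].
  by rewrite -ltnS (leq_trans _ le) // ltn_add2l.
by rewrite eg; apply/divides_polyC_cons.
Qed.

Hypothesis R_factorial : factorial_ring R.

(* Removes the constants that pseudo-division introduces; this replaces passing *)
(* to polynomials over the fraction field.                                      *)
Lemma cancel_polyC c f q h : c != 0 -> c%:P * f = q * h ->
  exists e q' h', [/\ e != 0, h = e%:P * h' & f = q' * h'].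
Proof.
case: R_factorial => irrP fac /fac[u [s [uU irr ->]]].
elim: s irr q h => [|p s IH] irr q h.
  rewrite big_nil mulr1 => e; exists 1, (u^-1%:P * q), h.
  by rewrite oner_neq0 mul1r -mulrA -e mulrA -polyCM mulVr // mul1r.
rewrite big_cons => e; have ps : irreducible_elt p by apply: irr; rewrite mem_head.
have p0 : p%:P != 0 :> {poly R} by rewrite polyC_eq0; case: ps.
have irr' q' : q' \in s -> irreducible_elt q'.
  by move=> qs; apply: irr; rewrite inE qs orbT.
have [_ _ pP] := prime_polyC (irrP _ ps).
have /pP[[q1 eq]|[h1 eh]] : divides p%:P (q * h).
  by exists ((u * \prod_(j <- s) j)%:P * f); rewrite -e mulrCA polyCM mulrA.
- apply: (IH irr' q1 h); apply: (mulfI p0).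
  by rewrite mulrA -polyCM mulrCA e eq mulrA.
- have [|d [q' [h' [d0 eh' ef]]]] := IH irr' q h1.
    by apply: (mulfI p0); rewrite mulrA -polyCM mulrCA e eh mulrCA.
  exists (p * d), q', h'; split=> //.
    by rewrite mulf_neq0 //; case: ps.
  by rewrite eh eh' polyCM mulrA.
Qed.

(** If c * f = w * g, cancelling c writes g = e * h and f = q * h with e constant. One of e and h is
    a unit, and it is not h, since g would then be constant. *)
Lemma irreducible_dividesCM g c f : irreducible_elt g -> (1 < size g)%N -> c != 0 ->
  divides g (c%:P * f) -> divides g f.
Proof.
case=> g0 gU gI sg c0 [w]; rewrite mulrC [g * w]mulrC [f * _]mulrC.
case/(cancel_polyC c0) => e [q [h [e0 eg ef]]].
case: (gI _ _ eg) => [eU|hU].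
  by exists (q * e%:P^-1); rewrite ef eg [RHS]mulrCA (mulrC e%:P) mulrK.
have : (size g <= 1)%N.
  rewrite eg mul_polyC (leq_trans (size_scale_leq _ _)) //.
  by move: hU; rewrite poly_unitE => /andP[/eqP->].
by rewrite leqNgt sg.
Qed.

(* The pseudo-gcd h = u * g + v * a of g and a is, up to constants, either 1 or *)
(* g, since it pseudo-divides the irreducible g.                                *)
Lemma irreducible_prime_nonconst g : irreducible_elt g -> (1 < size g)%N -> prime_elt g.
Proof.
move=> gi sg; have [g0 gU gI] := gi; split=> // a b dab.
have [[u v] /= Bez] := Pdiv.CommonIdomain.Bezoutp g a.
set h := u * g + v * a in Bez.
have /Pdiv.WeakIdomain.dvdpP[[c1 q1] /= c10 e1] : Pdiv.IdomainDefs.dvdp h g.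
  by rewrite (Pdiv.CommonIdomain.eqp_dvdl _ Bez) Pdiv.CommonIdomain.dvdp_gcdl.
have /Pdiv.WeakIdomain.dvdpP[[c2 q2] /= c20 e2] : Pdiv.IdomainDefs.dvdp h a.
  by rewrite (Pdiv.CommonIdomain.eqp_dvdl _ Bez) Pdiv.CommonIdomain.dvdp_gcdr.
rewrite -mul_polyC in e1; rewrite -mul_polyC in e2.
have [e [q [h' [e0 eh eg]]]] := cancel_polyC c10 e1.
(* Here g = q * h' and h = e * h'. A unit q makes g divide h, hence c2 * a; a unit h' makes h the
   constant e up to a unit, and g divides h * b. *)
case: (gI _ _ eg) => [qU|hU].
  left; apply: (irreducible_dividesCM gi sg c20); rewrite e2.
  by apply: divides_mull; exists (e%:P * q^-1); rewrite eh eg [RHS]mulrCA (mulrC q) mulrK.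
right; apply: (irreducible_dividesCM gi sg e0).
suff : divides g (h * b).
  case=> w ew; exists (w * h'^-1).
  by rewrite mulrA -ew eh mulrAC mulrK.
rewrite mulrDl; apply: divides_add; last by rewrite -mulrA; apply: divides_mull.
by apply: divides_mulr; apply: divides_mull; exists 1; rewrite mulr1.
Qed.

Lemma irreducible_polyC c : irreducible_elt c%:P -> irreducible_elt c.
Proof.
case=> c0 cU cI; split=> [||a b e]; first by rewrite -polyC_eq0.
  by move: cU; rewrite poly_unitE coefC size_polyC -(polyC_eq0 c) c0.
have := cI a%:P b%:P; rewrite -polyCM e => /(_ erefl).
by rewrite !poly_unitE !coefC => -[] /andP[_]; [left|right].
Qed.

Theorem irreducible_prime_poly g : irreducible_elt g -> prime_elt g.
Proof.
move=> gi; have [|sg] := ltnP 1 (size g); first exact: irreducible_prime_nonconst.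
rewrite (size1_polyC sg) in gi *; apply: prime_polyC.
by apply: R_factorial.1; apply: irreducible_polyC.
Qed.

End Gauss.

(** * Factorization and primality in several variables *)

Section MpolyFactorial.
Variable F : fieldType.

Lemma mpoly_unitP n (f : {mpoly F[n]}) :
  reflect (exists2 c, c != 0 & f = c%:MP) (f \is a GRing.unit).
Proof.
apply: (iffP andP) => [[/eqP e]|[c c0 ->]]; rewrite ?unitfE.
  by exists f@_0.
by rewrite mcoeffC eqxx mulr1; split; rewrite ?unitfE ?c0.
Qed.

Lemma msize_nonunit n (f : {mpoly F[n]}) :
  f != 0 -> f \isn't a GRing.unit -> (1 < msize f)%N.
Proof.
move=> f0; apply: contraR; rewrite -leqNgt => /msize1_polyC e.
by apply/mpoly_unitP; exists f@_0 => //; apply: contra f0 => /eqP c0; rewrite e c0.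
Qed.

(** Strong induction on the total degree: both factors of a proper factorization are nonconstant,
    hence of smaller degree. *)
Lemma mpoly_irreducible_factors n (f : {mpoly F[n]}) : f != 0 ->
  exists u (s : seq {mpoly F[n]}),
    [/\ u \is a GRing.unit, forall p, p \in s -> irreducible_elt p
      & f = u * \prod_(p <- s) p].
Proof.
have [d le] := ubnP (msize f); elim: d f le => // d IH f le f0.
have [fU|fU] := boolP (f \is a GRing.unit).
  by exists f, [::]; rewrite big_nil mulr1.
have [fi|nfi] := pselect (irreducible_elt f).
  exists 1, [:: f]; rewrite unitr1 big_seq1 mul1r; split=> // p.
  by rewrite inE => /eqP->.
have [g [h [e gU hU]]] : exists g h,
    [/\ f = g * h, g \isn't a GRing.unit & h \isn't a GRing.unit].
  apply: contrapT => nex; apply: nfi; split=> // g h e.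
  have [gU|gU] := boolP (g \is a GRing.unit); first by left.
  have [hU|hU] := boolP (h \is a GRing.unit); first by right.
  by case: nex; exists g, h.
have g0 : g != 0 by apply: contra f0 => /eqP g0; rewrite e g0 mul0r.
have h0 : h != 0 by apply: contra f0 => /eqP h0; rewrite e h0 mulr0.
have sg := msize_nonunit g0 gU; have sh := msize_nonunit h0 hU.
have [lg lh] : (msize g < d)%N /\ (msize h < d)%N.
  by move: le sg sh; rewrite e msizeM //; move: (msize g) (msize h) => x y; lia.
rewrite e; have [u [s [uU si ->]]] := IH g lg g0.
have [v [t [vU ti ->]]] := IH h lh h0.
exists (u * v), (s ++ t); rewrite unitrM uU vU big_cat /= mulrACA; split=> // p.
by rewrite mem_cat => /orP[/si|/ti].
Qed.

(** [muni] turns the last variable into the variable of a univariate polynomial; a monomial is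
    determined by its last exponent and the others, so no coefficients merge. *)
Lemma mcoeff_muni n (p : {mpoly F[n.+1]}) (m : 'X_{1..n.+1}) :
  (muni p)`_(m ord_max)@_[multinom m (widen_ord (leqnSn n) i) | i < n] = p@_m.
Proof.
have E (m' : 'X_{1..n.+1}) : (m' == m) =
    ([multinom m' (widen_ord (leqnSn n) i) | i < n] ==
       [multinom m (widen_ord (leqnSn n) i) | i < n])
    && (m ord_max == m' ord_max).
  apply/eqP/andP => [->//|[/eqP e /eqP e']]; apply/mnmP => i.
  have [j ->|->] := unliftP ord_max i; last by rewrite e'.
  have /(congr1 (fun x : 'X_{1..n} => x j)) := e; rewrite !mnmE.
  by congr (_ = _); congr (fun_of_multinom _ _); apply: val_inj;
    rewrite /= /bump leqNgt ltn_ord.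
rewrite muniE coef_sum raddf_sum /= [in RHS](mpolyE p) raddf_sum /=.
apply: eq_bigr => m' _; rewrite coefZ coefXn mcoeffZ mcoeffX E.
case: (m ord_max == _); rewrite ?mulr0 ?mcoeff0 ?andbF ?mulr0 //.
by rewrite mulr1 mcoeffZ mcoeffX andbT.
Qed.

Lemma muni_inj n : injective (@muni n F).
Proof. by move=> p q e; apply/mpolyP => m; rewrite -!mcoeff_muni e. Qed.

Lemma muni_surj n (f : {poly {mpoly F[n]}}) : exists p, muni p = f.
Proof.
have muniX (m : 'X_{1..n.+1}) : muni 'X_[m] =
    'X_[[multinom m (widen_ord (leqnSn n) i) | i < n]] *: 'X^(m ord_max)
      :> {poly {mpoly F[n]}}.
  by rewrite muniE msuppX big_seq1 mcoeffX eqxx scale1r.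
exists (\sum_(i < size f) mwiden f`_i * 'X_ord_max ^+ i).
rewrite raddf_sum /= -[RHS]coefK poly_def; apply: eq_bigr => i _.
rewrite rmorphM rmorphXn /= muniX mnmE eqxx expr1.
set z := [multinom _ | _ < _].
have -> : z = 0%MM.
  apply/mnmP => j; rewrite !mnmE; case: eqP => // /(congr1 val)/= e.
  by have := ltn_ord j; rewrite -e ltnn.
rewrite mpolyX0 scale1r -mul_polyC; congr (_ * _).
move: (f`_i) => c; rewrite [in LHS](mpolyE c) [in RHS](mpolyE c).
rewrite (raddf_sum (@mwiden n F)) (raddf_sum (@muni n F)).
rewrite (raddf_sum (@polyC {mpoly F[n]})).
apply: eq_bigr => m _ /=; rewrite mwidenZ mwidenX muniZ muniX mnmwiden_ordmax expr0.
rewrite alg_polyC -mul_polyC -polyCM mul_mpolyC; congr (_ *: 'X_[_])%:P.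
by apply/mnmP => j; rewrite mnmE mnmwiden_widen.
Qed.

End MpolyFactorial.

Lemma iso_irreducible_prime (R S : idomainType) (f : {rmorphism R -> S}) :
  injective f -> (forall y, exists x, f x = y) ->
  (forall y : S, irreducible_elt y -> prime_elt y) ->
  forall x : R, irreducible_elt x -> prime_elt x.
Proof.
move=> fi fs SP x; have fU a : (f a \is a GRing.unit) = (a \is a GRing.unit).
  apply/idP/idP; last exact: rmorph_unit.
  case/unitrPr=> y; have [b <-] := fs y; rewrite -rmorphM -(rmorph1 f) => /fi e.
  by apply/unitrPr; exists b.
have fd a b : divides (f a) (f b) <-> divides a b.
  split=> [[y]|[c ->]]; last by exists (f c); rewrite rmorphM.
  by have [c <-] := fs y; rewrite -rmorphM => /fi; exists c.
case=> x0 xU xI.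
have [|fx0 fxU fxP] := SP (f x).
  split=> [||a b].
  - by rewrite -(rmorph0 f) (inj_eq fi).
  - by rewrite fU.
  - have [a' <-] := fs a; have [b' <-] := fs b; rewrite -rmorphM !fU => /fi.
    exact: xI.
by split=> // a b /fd; rewrite rmorphM => /fxP; rewrite !fd.
Qed.

Theorem mpoly_irreducible_prime (F : fieldType) n (p : {mpoly F[n]}) :
  irreducible_elt p -> prime_elt p.
Proof.
elim: n p => [|n IH] p.
  (* Without variables every nonzero polynomial is a constant, hence a unit, so none is
     irreducible. *)
  case=> p0 pU _; case/negP: pU; apply/mpoly_unitP; exists p@_0.
    apply: contra p0 => /eqP p0; apply/eqP/mpolyP => m; rewrite mcoeff0.
    by rewrite (_ : m = 0%MM) //; apply/mnmP; case.
  by apply/mpolyP => m; rewrite mcoeffC (_ : m = 0%MM) ?eqxx ?mulr1 //; apply/mnmP; case.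
apply: (@iso_irreducible_prime _ _ (@muni n F)); first exact: muni_inj.
  exact: muni_surj.
move=> y; apply: irreducible_prime_poly; split; first exact: IH.
exact: mpoly_irreducible_factors.
Qed.

(** * Vector degrees and monic polynomials *)

Section VectorDegree.
Variables (F : finFieldType) (k : nat).
Implicit Types (f g : {mpoly F[k]}) (m : 'X_{1..k}).

(* Substituting X_j |-> X_j * T ^ (i == j) makes the degree in X_i the degree *)
(* in T, where {poly _} provides additivity.                                  *)
Let split_var (i : 'I_k) : {mpoly F[k]} -> {poly {mpoly F[k]}} :=
  mmap (polyC \o @mpolyC k F) (fun j => ('X_j)%:P * 'X^(i == j)).

Let split_varM i f g : split_var i (f * g) = split_var i f * split_var i g.
Proof. exact: rmorphM. Qed.

Let coef_split_var i f d m : (split_var i f)`_d@_m = f@_m *+ (m i == d).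
Proof.
have mmap1E m' : mmap1 (fun j => ('X_j)%:P * 'X^(i == j)) m' =
    ('X_[m'])%:P * 'X^(m' i) :> {poly {mpoly F[k]}}.
  rewrite /mmap1.
  rewrite (eq_bigr (fun j => ('X_j ^+ m' j)%:P * 'X^((i == j) * m' j))); last first.
    by move=> j _; rewrite exprMn -exprM rmorphXn.
  rewrite big_split /= -rmorph_prod -mpolyXE_id; congr (_ * _).
  rewrite (bigD1 i) //= eqxx mul1n big1 ?mulr1 // => j ji.
  by rewrite eq_sym (negPf ji) expr0.
rewrite /split_var /mmap coef_sum raddf_sum /=.
rewrite [in RHS](mpolyE f) raddf_sum /= -sumrMnl; apply: eq_bigr => m' _.
rewrite mmap1E mulrA -polyCM coefCM coefXn mul_mpolyC.
rewrite -scalerAl !mcoeffZ mulr_natr mcoeffMn mcoeffX.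
have [->|_] := eqVneq m' m; last by rewrite mul0rn !mulr0 mul0rn.
by rewrite eq_sym mulrnAr.
Qed.

(** Distinct monomials of f stay distinct under [split_var], so no cancellation lowers the degree in
    T. *)
Let size_split_var i f : f != 0 -> size (split_var i f) = (vdeg f i).+1.
Proof.
move=> f0; have lt e : e \in msupp f -> (e i < size (split_var i f))%N.
  rewrite mcoeff_msupp; apply: contraR; rewrite -leqNgt => le.
  have := coef_split_var i f (e i) e.
  by rewrite nth_default // mcoeff0 eqxx mulr1n => <-.
apply/eqP; rewrite eqn_leq mnmE; apply/andP; split.
  apply/leq_sizeP => j lej; apply/mpolyP => e; rewrite coef_split_var mcoeff0.
  case: eqP => // ej; rewrite mulr1n; apply: memN_msupp_eq0.
  apply/negP => es; move: lej; rewrite -ej ltnNge => /negP; apply.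
  exact: (leq_bigmax_seq e es).
move: (lt _ (mlead_supp f0)); case: (size _) lt => // s lt _; rewrite ltnS.
by apply/bigmax_leqP_seq => e es _; rewrite -ltnS lt.
Qed.

Lemma vdegM f g : f != 0 -> g != 0 -> vdeg (f * g) = (vdeg f + vdeg g)%MM.
Proof.
move=> f0 g0; apply/mnmP => i; rewrite mnmDE; apply: succn_inj.
rewrite -(size_split_var i (mulf_neq0 f0 g0)) split_varM.
move: (split_var i f) (split_var i g) (size_split_var i f0) (size_split_var i g0).
move=> u v su sv; have u0 : u != 0 by rewrite -size_poly_gt0 su.
have v0 : v != 0 by rewrite -size_poly_gt0 sv.
by rewrite (size_mul u0 v0) su sv addSn addnS.
Qed.

Lemma vdeg_unit f : f != 0 -> (f \is a GRing.unit) = (vdeg f == 0%MM).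
Proof.
move=> f0; apply/mpoly_unitP/eqP => [[c c0 ->]|v0].
  apply/mnmP => i; rewrite mnmE msuppC (negPf c0) big_seq1 !mnm0E //.
have /msize1_polyC e : (msize f <= 1)%N.
  rewrite msizeE; apply/bigmax_leqP_seq => e ef _.
  rewrite ltnS leqn0 mdeg_eq0; apply/eqP/mnmP => i; rewrite mnm0E; apply/eqP.
  rewrite -leqn0 -(mnm0E i) -v0 mnmE.
  exact: (leq_bigmax_seq e ef).
by exists f@_0 => //; apply: contra f0 => /eqP c0; rewrite e c0.
Qed.

Lemma vdeg1 : vdeg (1 : {mpoly F[k]}) = 0%MM.
Proof. by apply/eqP; rewrite -vdeg_unit ?unitr1 ?oner_neq0. Qed.

Lemma vdegZ (c : F) f : c != 0 -> vdeg (c *: f) = vdeg f.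
Proof.
move=> c0; have [->|f0] := eqVneq f 0; first by rewrite scaler0.
have c0' : c%:MP != 0 :> {mpoly F[k]} by rewrite mpolyC_eq0.
rewrite -mul_mpolyC vdegM // (_ : vdeg _ = 0%MM) ?add0m //.
by apply/eqP; rewrite -vdeg_unit //; apply/mpoly_unitP; exists c.
Qed.

Lemma vdeg_prod (I : Type) (r : seq I) (f : I -> {mpoly F[k]}) :
  (forall i, f i != 0) ->
  vdeg (\prod_(i <- r) f i) = (\sum_(i <- r) vdeg (f i))%MM.
Proof.
move=> f0; elim: r => [|i r IH]; first by rewrite !big_nil vdeg1.
rewrite !big_cons vdegM ?IH //.
by elim/big_rec: _ => [|j g _]; [exact: oner_neq0 | exact: mulf_neq0].
Qed.

Lemma vdegX f n : f != 0 -> vdeg (f ^+ n) = (vdeg f *+ n)%MM.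
Proof.
move=> f0; elim: n => [|n IH]; first by rewrite expr0 vdeg1.
by rewrite exprS vdegM ?expf_neq0 // IH mulmS.
Qed.

Lemma vdeg_irreducible f : irreducible_elt f -> (0 < vdeg f)%MM.
Proof.
case=> f0 fU _; apply/andP; split; first by rewrite eq_sym -vdeg_unit.
by apply/mnm_lepP => i; rewrite mnm0E.
Qed.

(** The leading coefficient for the monomial order selects one polynomial in each class of nonzero
    polynomials, compatibly with products. *)
Definition mmonic f := mleadc f == 1.

Lemma mmonic_neq0 f : mmonic f -> f != 0.
Proof. by apply: contraL => /eqP->; rewrite /mmonic mleadc0 eq_sym oner_eq0. Qed.

Lemma mmonicM f g : mmonic f -> mmonic g -> mmonic (f * g).
Proof.
move=> /eqP mf /eqP mg; rewrite /mmonic mleadcM_proper mf mg mul1r //.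
exact: oner_neq0.
Qed.

Lemma mmonic1 : mmonic (1 : {mpoly F[k]}).
Proof. by rewrite /mmonic mleadc1. Qed.

Lemma mmonic_prod (I : Type) (r : seq I) (f : I -> {mpoly F[k]}) :
  (forall i, mmonic (f i)) -> mmonic (\prod_(i <- r) f i).
Proof.
by move=> mf; elim/big_rec: _ => [|i g _]; [exact: mmonic1 | exact: mmonicM].
Qed.

Lemma mmonicX f n : mmonic f -> mmonic (f ^+ n).
Proof.
by move=> mf; elim: n => [|n IH]; rewrite ?expr0 ?mmonic1 // exprS mmonicM.
Qed.

Lemma mmonicZ_eq (c : F) f g : mmonic f -> mmonic g -> f = c *: g -> f = g.
Proof.
move=> /eqP mf /eqP mg e; move: mf.
by rewrite e mleadcZE mg mulr1 => ->; rewrite scale1r.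
Qed.

Lemma mmonic_normalize f : f != 0 -> mmonic ((mleadc f)^-1 *: f).
Proof. by move=> f0; rewrite /mmonic mleadcZE mulVf // mleadc_eq0. Qed.

Lemma irreducible_eltZ (c : F) f :
  c != 0 -> irreducible_elt f -> irreducible_elt (c *: f).
Proof.
move=> c0 [f0 fU fI]; split=> [||g h e].
- by rewrite scaler_eq0 negb_or c0.
- by rewrite vdeg_unit ?vdegZ -?vdeg_unit // scaler_eq0 negb_or c0.
have : f = (c^-1 *: g) * h by rewrite -scalerAl -e scalerA mulVf // scale1r.
case/fI => [gU|]; last by right.
left; have g0 : g != 0.
  by apply: contraTneq gU => ->; rewrite scaler0 unitr0.
have ci : c^-1 != 0 by rewrite invr_eq0.
by move: gU; rewrite !vdeg_unit ?vdegZ // scaler_eq0 negb_or ci.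
Qed.

Lemma mmonic_irreducible_divides f g :
  irreducible_elt f -> mmonic f -> irreducible_elt g -> mmonic g ->
  divides f g -> f = g.
Proof.
case=> _ fU _ mf [_ _ gI] mg [h e]; case: (gI _ _ e) => [fU'|].
  by rewrite fU' in fU.
case/mpoly_unitP=> c _ hc; apply/esym/(@mmonicZ_eq c) => //.
by rewrite e hc mulrC mul_mpolyC.
Qed.

Lemma mmonic_factors f : mmonic f -> exists s : seq {mpoly F[k]},
  (forall p, p \in s -> irreducible_elt p /\ mmonic p) /\ f = \prod_(p <- s) p.
Proof.
move=> mf; have [u [s [uU si e]]] := mpoly_irreducible_factors (mmonic_neq0 mf).
have s0 p : p \in s -> p != 0 by case/si.
pose n p := (mleadc p)^-1 *: p : {mpoly F[k]}.
have nP q : q \in map n s -> irreducible_elt q /\ mmonic q.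
  case/mapP=> p ps ->; split; last exact/mmonic_normalize/s0.
  by apply: irreducible_eltZ; [rewrite invr_eq0 mleadc_eq0 s0|apply: si].
exists (map n s); split=> //.
have mp : mmonic (\prod_(p <- map n s) p).
  rewrite big_seq; elim/big_rec: _ => [|q g /nP[_ mq] mg]; first exact: mmonic1.
  exact: mmonicM.
(* The leading coefficients split off from the factors combine into one constant, which disappears
   because both sides are monic. *)
have [c ec] : exists c, \prod_(p <- s) p = c *: \prod_(p <- map n s) p.
  elim: s s0 {si e nP mp} => [|p s IH] s0.
    by exists 1; rewrite !big_nil scale1r.
  have [q qs|c e] := IH; first by apply: s0; rewrite inE qs orbT.
  exists (mleadc p * c); rewrite /= !big_cons e -scalerAl -!scalerAr !scalerA.
  by rewrite mulrAC mulfV ?mul1r // mleadc_eq0 s0 ?mem_head.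
case/mpoly_unitP: uU => d _ ud; apply: (@mmonicZ_eq (d * c)) => //.
by rewrite e ud ec mul_mpolyC scalerA.
Qed.

End VectorDegree.

(** * Counting multisets *)

Section MultisetCount.
Variable n : nat.

(** Multisets on A are encoded as multiplicity functions vanishing off A; the bound n keeps the type
    finite. Enumerating A turns them into the tuples of sum a counted by [card_ord_partitions]. *)
Lemma card_multiset (T : finType) (A : {set T}) (a : nat) : (a <= n)%N ->
  #|[set b : {ffun T -> 'I_n.+1} | [forall t in ~: A, b t == ord0]
       & \sum_(t in A) b t == a]%N| = 'C(#|A| + a - 1, a).
Proof.
(* With A empty only the zero function remains, and it counts only for a = 0, where the truncated
   subtraction gives 'C(0, 0) = 1. *)
move=> an; have [A0|] := posnP #|A|.
  rewrite A0 add0n; move/cards0_eq: A0 => A0.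
  pose z : {ffun T -> 'I_n.+1} := [ffun=> ord0].
  case: a an => [|a] an; last first.
    rewrite bin_small ?subn1 //; apply: eq_card0 => b.
    by rewrite !inE A0 big_set0 andbF.
  rewrite bin0 -(cards1 z); apply: eq_card => b.
  rewrite !inE A0 big_set0 eqxx andbT; apply/forall_inP/eqP => [b0|-> t _].
    by apply/ffunP => t; rewrite ffunE; apply/eqP/b0; rewrite !inE.
  by rewrite ffunE.
case eA : #|A| => [//|p] _; rewrite addSn subn1 /=.
have -> : 'C(p + a, a) = 'C(p + a, p).
  by rewrite -[RHS]bin_sub ?leq_addr // addKn.
rewrite -card_ord_partitions.
pose e (i : 'I_p.+1) : T := enum_val (cast_ord (esym eA) i).
have e_inj : injective e by move=> i j /enum_val_inj/cast_ord_inj.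
have eP i : e i \in A by apply: enum_valP.
have sumE (f : T -> nat) : (\sum_(t in A) f t = \sum_(i < p.+1) f (e i))%N.
  rewrite (reindex_onto e (fun t => cast_ord eA (enum_rank_in (eP ord0) t))).
    apply: eq_bigl => i; rewrite eP; apply/eqP; apply: e_inj.
    by rewrite [in LHS]/e cast_ordK enum_rankK_in ?eP.
  by move=> t tA; rewrite /e cast_ordK enum_rankK_in.
(* Carries a tuple to A along [e], with 0 elsewhere: as [e] is injective, each sum has at most one
   term. *)
pose g (t : p.+1.-tuple 'I_a.+1) : {ffun T -> 'I_n.+1} :=
  [ffun x => inord (\sum_(i | e i == x) tnth t i)%N].
have ge (t : p.+1.-tuple 'I_a.+1) i :
    (\sum_(i <- t) i <= a)%N -> g t (e i) = tnth t i :> nat.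
  move=> ta; rewrite ffunE (eq_bigl (pred1 i)) => [|j]; last by rewrite /= (inj_eq e_inj).
  by rewrite big_pred1_eq inordK // (leq_trans (ltn_ord _)).
have sumt (t : p.+1.-tuple 'I_a.+1) : (\sum_(i <- t) i = \sum_(i < p.+1) tnth t i)%N.
  by rewrite big_tuple.
symmetry; rewrite -(@card_in_imset _ _ g); last first.
  move=> t t'; rewrite !inE => /eqP ta /eqP ta' /ffunP gg.
  apply: eq_from_tnth => i; apply: val_inj => /=.
  by rewrite -!ge ?ta ?ta' // gg.
congr #|pred_of_set _|; apply/setP => b; rewrite inE; apply/imsetP/andP.
  case=> t; rewrite inE => /eqP ta ->; split.
    apply/forall_inP => x; rewrite inE => xA; rewrite ffunE big_pred0.
      by apply/eqP/val_inj; rewrite /= inordK.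
    by move=> i; apply: contraNF xA => /eqP <-.
  rewrite sumE -[X in _ == X]ta sumt; apply/eqP/eq_bigr => i _.
  by rewrite ge ?ta.
case=> /forall_inP b0 /eqP ba.
have lea i : (b (e i) < a.+1)%N.
  by rewrite ltnS -ba sumE (bigD1 i) //= leq_addr.
have st : (\sum_(i <- [tuple (inord (b (e i)) : 'I_a.+1) | i < p.+1]) i = a)%N.
  by rewrite sumt -[RHS]ba sumE; apply: eq_bigr => i _; rewrite tnth_mktuple inordK.
exists [tuple inord (b (e i)) | i < p.+1]; first by rewrite inE st.
apply/ffunP => x; apply: ord_inj; have [xA|xA] := boolP (x \in A).
  have -> : x = e (cast_ord eA (enum_rank_in (eP ord0) x)).
    by rewrite /e cast_ordK enum_rankK_in.
  by rewrite ge ?st // tnth_mktuple inordK.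
have /eqP-> : b x == ord0 by apply: b0; rewrite inE.
rewrite ffunE big_pred0 ?inordK // => i.
by apply: contraNF xA => /eqP <-.
Qed.

(** The condition for i concerns only the values on the fibre of d over i, so multisets are chosen
    independently on the fibres; [h] glues them. *)
Lemma card_graded_multiset (T B : finType) (d : T -> B) (a : B -> nat) :
  (forall i, a i <= n)%N ->
  #|[set b : {ffun T -> 'I_n.+1} |
       [forall i, \sum_(t | d t == i) b t == a i]%N]| =
  (\prod_i 'C(#|[set t | d t == i]| + a i - 1, a i))%N.
Proof.
move=> an; pose A i := [set t | d t == i].
pose M i : {set {ffun T -> 'I_n.+1}} := [set b : {ffun T -> 'I_n.+1} |
   [forall t in ~: A i, b t == ord0] & \sum_(t in A i) b t == a i]%N.
transitivity (#|family M|); last first.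
  rewrite card_family foldrE big_map big_enum /=.
  by apply: eq_bigr => i _; apply: card_multiset.
pose h (f : {ffun B -> {ffun T -> 'I_n.+1}}) : {ffun T -> 'I_n.+1} :=
  [ffun t => f (d t) t].
have hsum f i : (\sum_(t | d t == i) h f t = \sum_(t in A i) f i t)%N.
  rewrite [RHS](eq_bigl (fun t => d t == i)) => [|t]; last by rewrite inE.
  by apply: eq_bigr => t /eqP <-; rewrite ffunE.
have fM f i t : f \in family M -> d t != i -> f i t = ord0.
  move/familyP/(_ i); rewrite inE => /andP[/forall_inP f0 _] ti.
  by apply/eqP/f0; rewrite !inE.
rewrite -(@card_in_imset _ _ h) => [|f f' fm fm' /ffunP hh]; last first.
  apply/ffunP => i; apply/ffunP => t; have [ti|ti] := eqVneq (d t) i.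
    by have := hh t; rewrite !ffunE ti.
  by rewrite !fM.
congr #|pred_of_set _|; apply/setP => b; rewrite inE; apply/forallP/imsetP.
  move=> bP; pose f : {ffun B -> {ffun T -> 'I_n.+1}} :=
    [ffun i => [ffun t => if d t == i then b t else ord0]].
  have bf : b = h f by apply/ffunP => t; rewrite !ffunE eqxx.
  exists f => //; apply/familyP => i; rewrite inE -hsum -bf bP andbT.
  by apply/forall_inP => t; rewrite !inE !ffunE => /negPf->.
case=> f /[dup] fm /familyP fP -> i; rewrite hsum.
by have := fP i; rewrite inE => /andP[].
Qed.

End MultisetCount.

Lemma card_fset_set_finType (T : finType) (A : {set T}) :
  #|` fset_set [set x | x \in A]%classic| = #|A|.
Proof.
rewrite cardE; apply/perm_size/uniq_perm; rewrite ?enum_uniq ?fset_uniq //.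
move=> x; rewrite mem_enum in_fset_set; last exact: finite_finset.
by apply/idP/idP; rewrite ?inE.
Qed.

(** * Uniqueness of factorization in terms of exponents *)

Section UniqueFactorization.
Variables (F : finFieldType) (k : nat) (T : finType) (p : T -> {mpoly F[k]}).
Hypotheses (p_inj : injective p) (p_irr : forall t, irreducible_elt (p t)).
Hypothesis p_monic : forall t, mmonic (p t).
Implicit Types (a b : T -> nat).

(** If b t < a t, cancelling p t ^+ b t leaves p t dividing the product of the other powers. Being
    prime, it divides, hence equals, some p j with j != t. *)
Lemma prod_irreducible_exp_le a b : \prod_t p t ^+ a t = \prod_t p t ^+ b t ->
  forall t, (a t <= b t)%N.
Proof.
move=> e t; rewrite leqNgt; apply/negP => lt.
have pt := mpoly_irreducible_prime (p_irr t).
have : divides (p t) (\prod_(j | j != t) p j ^+ b j).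
  exists (p t ^+ (a t - b t).-1 * \prod_(j | j != t) p j ^+ a j).
  apply: (mulfI (expf_neq0 (b t) (mmonic_neq0 (p_monic t)))).
  rewrite (mulrA (p t)) -exprS prednK ?subn_gt0 // mulrA -exprD subnKC 1?ltnW //.
  by move: e; rewrite (bigD1 t) //= [in RHS](bigD1 t) //=.
case/(prime_divides_prod pt) => j jt /(prime_divides_exp pt) => dj.
have /p_inj tj :=
  mmonic_irreducible_divides (p_irr t) (p_monic t) (p_irr j) (p_monic j) dj.
by rewrite tj eqxx in jt.
Qed.

Lemma prod_irreducible_exp_inj a b :
  \prod_t p t ^+ a t = \prod_t p t ^+ b t -> a =1 b.
Proof.
move=> e t; apply/eqP; rewrite eqn_leq.
by rewrite (prod_irreducible_exp_le e) (prod_irreducible_exp_le (esym e)).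
Qed.

Lemma prod_count_exp (s : seq {mpoly F[k]}) :
  (forall x, x \in s -> exists t, p t = x) ->
  \prod_(x <- s) x = \prod_t p t ^+ count_mem (p t) s.
Proof.
elim: s => [|x s IH] sP; first by rewrite big_nil big1.
have [t tx] := sP x (mem_head _ _).
rewrite big_cons IH => [|y ys]; last by apply: sP; rewrite inE ys orbT.
rewrite /= [RHS](eq_bigr (fun t => p t ^+ (x == p t) * p t ^+ count_mem (p t) s)).
  rewrite big_split /=; congr (_ * _).
  rewrite (bigD1 t) //= tx eqxx big1 ?mulr1 ?expr1 // => j jt.
  by rewrite -tx (inj_eq p_inj) eq_sym (negPf jt).
by move=> j _; rewrite -exprD.
Qed.

Lemma vdeg_prod_exp a :
  vdeg (\prod_t p t ^+ a t) = (\sum_t vdeg (p t) *+ a t)%MM.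
Proof.
rewrite vdeg_prod => [|t]; last by rewrite expf_neq0 // mmonic_neq0.
by apply: eq_bigr => t _; rewrite vdegX // mmonic_neq0.
Qed.

Lemma mmonic_prod_exp a : mmonic (\prod_t p t ^+ a t).
Proof. by apply: mmonic_prod => t; apply: mmonicX. Qed.

End UniqueFactorization.

(** * Weighted sums of tuples *)

Section Multinomials.
Variable k : nat.

Lemma mnm_sum_mulm (I : finType) (P : pred I) (v : 'X_{1..k}) (a : I -> nat) :
  (\sum_(i | P i) v *+ a i = v *+ \sum_(i | P i) a i)%MM.
Proof.
apply/mnmP => j; rewrite mnm_sumE mulmnE big_distrr /=.
by apply: eq_bigr => i _; rewrite mulmnE.
Qed.

(** A nonzero v i has total degree at least 1. This bound lets multiplicities live in a finite
    type. *)
Lemma leq_coef_mdeg (I : finType) (v : I -> 'X_{1..k}) (a : I -> nat) m i :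
  (0 < v i)%MM -> (\sum_i v i *+ a i)%MM = m -> (a i <= mdeg m)%N.
Proof.
move=> vi <-; rewrite mdeg_sum (bigD1 i) //= mdegMn.
apply: leq_trans (leq_addr _ _); rewrite leq_pmull // lt0n mdeg_eq0 eq_sym.
by case/andP: vi.
Qed.

Lemma tuple_of_gt0 (m : 'X_{1..k}) (i : between0 m) : (0 < Defs.tuple_of i)%MM.
Proof. by case/andP: (valP i). Qed.

End Multinomials.

(** * Monic representatives of normalized classes *)

Section Representatives.
Variables (F : finFieldType) (k : nat).
Implicit Types (f g : {mpoly F[k]}) (m : 'X_{1..k}).
Local Open Scope classical_set_scope.

Lemma normalizedZ (c : F) f : c != 0 -> normalized (c *: f) = normalized f.
Proof.
move=> c0; apply/seteqP; split=> g /= [d d0 ->].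
  by exists (d * c); rewrite ?mulf_neq0 ?scalerA.
by exists (d / c); rewrite ?mulf_neq0 ?invr_eq0 // scalerA divfK.
Qed.

(** Scaling gives each class a monic member, and two monic members of a class coincide. *)
Lemma card_normalized (P : set {mpoly F[k]}) : finite_set P ->
  (forall f, P f -> f != 0) ->
  (forall (c : F) f, c != 0 -> P f -> P (c *: f)) ->
  #|` fset_set (@normalized F k @` P)| =
  #|` fset_set (P `&` [set f | mmonic f])|.
Proof.
move=> Pfin P0 PZ.
have -> : @normalized F k @` P = @normalized F k @` (P `&` [set f | mmonic f]).
  apply/seteqP; split=> _ [f Pf <-]; last by case: Pf => Pf _; exists f.
  have f0 := P0 _ Pf; have c0 : (mleadc f)^-1 != 0 by rewrite invr_eq0 mleadc_eq0.
  exists ((mleadc f)^-1 *: f); last exact: normalizedZ.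
  by split; [apply: PZ | apply: mmonic_normalize].
have finI : finite_set (P `&` [set f | mmonic f]) by apply: sub_finite_set Pfin => f [].
rewrite fset_set_image // card_in_imfset // => f g /=.
rewrite !in_fset_set // !inE => -[_ mf] [_ mg] e.
have : normalized g f.
  by rewrite -e; exists 1; rewrite ?oner_neq0 ?scale1r.
by case=> c _; apply: mmonicZ_eq.
Qed.

Definition monic_irreducible m : set {mpoly F[k]} :=
  [set f | [/\ irreducible_elt f, mmonic f & vdeg f = m]].

(** Defined by negation, so at m = 0 it consists of the unit 1. *)
Definition monic_reducible m : set {mpoly F[k]} :=
  [set f | [/\ ~ irreducible_elt f, mmonic f & vdeg f = m]].

Lemma finite_monic_irreducible m : finite_set (monic_irreducible m).
Proof. by apply: sub_finite_set (finite_vdeg F m) => f []. Qed.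

Lemma finite_monic_reducible m : finite_set (monic_reducible m).
Proof. by apply: sub_finite_set (finite_vdeg F m) => f []. Qed.

Lemma Ik_monic m : Ik F m = #|` fset_set (monic_irreducible m)|.
Proof.
rewrite /Ik /normalized_irreducible_of_vdeg card_normalized.
- congr #|` fset_set _|; apply/seteqP; split=> f /=; first by case=> -[].
  by case.
- by apply: sub_finite_set (finite_vdeg F m) => f [].
- by move=> f [] [].
- move=> c f c0 [fi fm]; split; last by rewrite vdegZ.
  exact: irreducible_eltZ.
Qed.

Lemma Nk_monic m : Nk F m =
  (Ik F m + #|` fset_set (monic_reducible m)|)%N.
Proof.
rewrite Ik_monic /Nk /normalized_of_vdeg card_normalized.
- have dis : [disjoint fset_set (monic_irreducible m)
                     & fset_set (monic_reducible m)]%fset.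
    apply/fdisjointP => f; rewrite !in_fset_set;
      [|exact: finite_monic_reducible|exact: finite_monic_irreducible].
    by rewrite inE => -[fi _ _]; apply/negP; rewrite inE => -[].
  move: dis; rewrite -fsetI_eq0 => /eqP dis.
  have := cardfsU (fset_set (monic_irreducible m)) (fset_set (monic_reducible m)).
  rewrite dis cardfs0 subn0 => <-.
  rewrite -fset_setU; [|exact: finite_monic_irreducible|exact: finite_monic_reducible].
  congr #|` fset_set _|; apply/seteqP; split=> f /=.
    by move=> [[f0 fm] mf]; have [fi|fi] := pselect (irreducible_elt f); [left|right].
  by case=> -[_ mf fm]; do !split=> //; exact: mmonic_neq0.
- by apply: sub_finite_set (finite_vdeg F m) => f [].
- by move=> f [].
- by move=> c f c0 [f0 fm] /=; rewrite scaler_eq0 negb_or c0 vdegZ.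
Qed.

End Representatives.

(** * Counting reducible polynomials; the recursion *)

Section Recursion.
Variables (F : finFieldType) (k : nat).
Implicit Types (f g : {mpoly F[k]}) (m : 'X_{1..k}).

(** A copy of [families] in a finite type, so that sums over it are ordinary big operators. *)
Definition bounded_families m : {set {ffun between0 m -> 'I_(mdeg m).+1}} :=
  [set a : {ffun between0 m -> 'I_(mdeg m).+1} |
    (\sum_i Defs.tuple_of i *+ a i)%MM == m].

Lemma reducible_sum_bounded (J : 'X_{1..k} -> nat) m : reducible_sum J m =
  (\sum_(a in bounded_families m)
     \prod_(i : between0 m) 'C(J (Defs.tuple_of i) + a i - 1, a i))%N%:Z.
Proof.
pose h (a : {ffun between0 m -> 'I_(mdeg m).+1}) : {ffun between0 m -> nat} :=
  [ffun i => a i : nat].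
have sumh (a : {ffun between0 m -> 'I_(mdeg m).+1}) :
    (\sum_i Defs.tuple_of i *+ h a i = \sum_i Defs.tuple_of i *+ a i)%MM.
  by apply: eq_bigr => i _; rewrite ffunE.
have -> : reducible_sum J m =
    \sum_(a \in h @` [set` bounded_families m]%classic)
      (\prod_(i : between0 m) 'C(J (Defs.tuple_of i) + a i - 1, a i))%N%:Z.
  apply: eq_fsbigl; apply/seteqP; split=> a /=; last first.
    by case=> b; rewrite inE => /eqP bm <-; rewrite /families /= sumh.
  move=> am; have ha : h [ffun i => inord (a i)] = a.
    apply/ffunP => i; rewrite !ffunE inordK // ltnS.
    exact: leq_coef_mdeg (tuple_of_gt0 i) am.
  by exists [ffun i => inord (a i)] => //; rewrite inE -sumh ha am.
rewrite fsbig_image; last first.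
  move=> a b _ _ /ffunP e; apply/ffunP => i; apply: ord_inj.
  by have := e i; rewrite !ffunE.
rewrite -natz natr_sum -(@bigfs _ _ _ _ (index_enum _)) ?index_enum_uniq //=; last first.
  by move=> a _; rewrite mem_index_enum.
apply: eq_bigr => a _; rewrite natz; congr Posz.
by apply: eq_bigr => i _; rewrite ffunE.
Qed.

(** Unique factorization makes [h] a bijection from the exponent functions in [S] to the reducible
    polynomials; [r] then partitions [S] by the multiplicity in each degree. *)
Lemma card_monic_reducible m : (0 < m)%MM ->
  #|` fset_set (monic_reducible (F := F) m)| =
  (\sum_(a in bounded_families m)
     \prod_(i : between0 m) 'C(Ik F (Defs.tuple_of i) + a i - 1, a i))%N.
Proof.
move=> m0.
pose U := [set f : {mpoly F[k]} |
  [/\ irreducible_elt f, mmonic f & (vdeg f < m)%MM]]%classic.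
have finU : finite_set U.
  apply: (@sub_finite_set _ _ (\bigcup_(i in [set: between0 m])
    monic_irreducible (F := F) (Defs.tuple_of i))%classic).
    move=> f [fi mf fm]; have [|i im] := between0P m (vdeg f) _.
      by rewrite vdeg_irreducible.
    by exists i => //; split.
  apply: bigcup_finite => [|i _]; first exact: finite_finset.
  exact: finite_monic_irreducible.
pose T : finType := fset_set U.
pose p (t : T) : {mpoly F[k]} := fsval t.
have pU t : U (p t) by have := fsvalP t; rewrite in_fset_set // inE.
have p_inj : injective p by exact: val_inj.
have p_irr t : irreducible_elt (p t) by case: (pU t).
have p_monic t : mmonic (p t) by case: (pU t).
have p_all f : U f -> exists t, p t = f.
  move=> Uf; have fU : f \in fset_set U by rewrite in_fset_set // inE.
  by exists (FSetSub fU).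
have [d dE] : {d : T -> between0 m & forall t, Defs.tuple_of (d t) = vdeg (p t)}.
  apply: (@choice _ _ (fun t i => Defs.tuple_of i = vdeg (p t))) => t.
  by apply/between0P; rewrite vdeg_irreducible //; case: (pU t).
have tuple_inj : injective (@Defs.tuple_of k m) by move=> i j /val_inj/val_inj.
(* The fibre of the grading [d] over i holds all monic irreducibles of that degree, since i < m. *)
have IkE i : Ik F (Defs.tuple_of i) = #|[set t | d t == i]|.
  rewrite Ik_monic -card_fset_set_finType.
  have -> : monic_irreducible (F := F) (Defs.tuple_of i) =
      (p @` [set t | t \in [set t | d t == i]%SET])%classic.
    apply/seteqP; split=> f /=.
      case=> fi mf fm; have [|t tf] := p_all f.
        by split=> //; rewrite fm; case/andP: (valP i).
      by exists t => //; rewrite inE; apply/eqP/tuple_inj; rewrite dE tf.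
    by case=> t; rewrite inE => /eqP ti <-; split; rewrite // -dE ti.
  by rewrite fset_set_image ?card_imfset //; exact: finite_finset.
pose S := [set b : {ffun T -> 'I_(mdeg m).+1} |
  (\sum_t vdeg (p t) *+ b t)%MM == m].
pose h (b : {ffun T -> 'I_(mdeg m).+1}) := \prod_t p t ^+ b t.
have -> : monic_reducible (F := F) m = (h @` [set b | b \in S])%classic.
  apply/seteqP; split=> f /=; last first.
    case=> b; rewrite inE => /eqP bm <-; split.
    (* An irreducible value of [h] would divide, hence equal, some p t, whose degree is below m. *)
    - move=> fi; have hp := mpoly_irreducible_prime fi.
      have hd : divides (h b) (\prod_t p t ^+ b t) by exists 1; rewrite mulr1.
      have [t _ /(prime_divides_exp hp) ht] := prime_divides_prod hp hd.
      have [_ _] := pU t; rewrite -(mmonic_irreducible_divides fi _ _ _ ht) //.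
        by rewrite vdeg_prod_exp // bm => /andP[]; rewrite eqxx.
      exact: mmonic_prod_exp.
    - exact: mmonic_prod_exp.
    - by rewrite vdeg_prod_exp.
  case=> nfi mf fm; have [s [sP fs]] := mmonic_factors mf.
  have f0 := mmonic_neq0 mf.
  (* If a factor x had degree m, its cofactor g would have degree 0 and be a constant, so f would be
     irreducible like x. *)
  have sT x : x \in s -> exists t, p t = x.
    move=> xs; have [xi mx] := sP x xs; apply: p_all; split=> //.
    have e : f = x * \prod_(y <- rem x s) y by rewrite fs (big_rem x).
    set g := \prod_(y <- _) y in e.
    have x0 := mmonic_neq0 mx.
    have g0 : g != 0 by apply: contra f0 => /eqP g0; rewrite e g0 mulr0.
    have dm : m = (vdeg x + vdeg g)%MM by rewrite -fm e vdegM.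
    apply/andP; split; last by rewrite dm lem_addr.
    apply/eqP => xm; apply: nfi.
    have : g \is a GRing.unit.
      by rewrite vdeg_unit //; apply/eqP/(@addmI _ (vdeg x)); rewrite -dm addm0 xm.
    case/mpoly_unitP => c c0 gc.
    by rewrite e gc mulrC mul_mpolyC; apply: irreducible_eltZ.
  have fe : f = \prod_t p t ^+ count_mem (p t) s by rewrite fs (prod_count_exp p_inj).
  have ce : (\sum_t vdeg (p t) *+ count_mem (p t) s)%MM = m.
    by rewrite -vdeg_prod_exp // -fe.
  have cle t : (count_mem (p t) s < (mdeg m).+1)%N.
    by rewrite ltnS (leq_coef_mdeg _ ce) // vdeg_irreducible.
  exists [ffun t => inord (count_mem (p t) s)].
    rewrite inE -[X in _ == X]ce; apply/eqP/eq_bigr => t _.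
    by rewrite ffunE inordK.
  by rewrite fe; apply: eq_bigr => t _; rewrite ffunE inordK.
rewrite fset_set_image; last exact: finite_finset.
rewrite card_imfset /=; last first.
  move=> b b' /(prod_irreducible_exp_inj p_inj p_irr p_monic) e.
  by apply/ffunP => t; apply: ord_inj; apply: e.
rewrite card_fset_set_finType.
have sumE (b : {ffun T -> 'I_(mdeg m).+1}) : (\sum_t vdeg (p t) *+ b t =
    \sum_i Defs.tuple_of i *+ \sum_(t | d t == i) b t)%MM.
  rewrite (partition_big d predT) //=; apply: eq_bigr => i _.
  by rewrite -mnm_sum_mulm; apply: eq_bigr => t /eqP <-; rewrite dE.
(* Total multiplicity in each degree; for b in [S] it is at most [mdeg m], so [inord] keeps its
   value. *)
pose r (b : {ffun T -> 'I_(mdeg m).+1}) : {ffun between0 m -> 'I_(mdeg m).+1} :=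
  [ffun i => inord (\sum_(t | d t == i) b t)%N].
have rE b i : b \in S -> r b i = (\sum_(t | d t == i) b t)%N :> nat.
  rewrite inE sumE ffunE => /eqP bm; rewrite inordK // ltnS.
  exact: leq_coef_mdeg (tuple_of_gt0 i) bm.
rewrite -sum1_card (partition_big r (mem (bounded_families m))) /=; last first.
  move=> b bS; rewrite inE; move: (bS); rewrite inE sumE => /eqP bm.
  by rewrite -[X in _ == X]bm; apply/eqP/eq_bigr => i _; rewrite rE.
apply: eq_bigr => a; rewrite inE => /eqP am.
under [RHS]eq_bigr => i _ do rewrite IkE.
rewrite -(@card_graded_multiset (mdeg m)) => [|i]; last by rewrite -ltnS.
rewrite -sum1_card; apply: eq_bigl => b; rewrite [in RHS]inE.
apply/andP/forallP => [[bS /eqP <-] i|ba]; first by rewrite rE.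
(* The prescribed multiplicities a already force the total degree m. *)
have bS : b \in S.
  by rewrite inE sumE -[X in _ == X]am; apply/eqP/eq_bigr => i _; rewrite (eqP (ba i)).
by split=> //; apply/eqP/ffunP => i; apply: ord_inj; rewrite rE // (eqP (ba i)).
Qed.

Lemma Ik0 : Ik F (0%MM : 'X_{1..k}) = 0%N.
Proof.
rewrite Ik_monic (_ : monic_irreducible _ = set0) ?fset_set0 ?cardfs0 //.
apply/seteqP; split=> // f [fi _ f0].
by have := vdeg_irreducible fi; rewrite f0 => /andP[]; rewrite eqxx.
Qed.

(** All indices in [between0 m] lie strictly below m, so the formula at m is a genuine recursion. *)
Lemma eq_reducible_sum (J J' : 'X_{1..k} -> nat) m :
  (forall i, (i < m)%MM -> J i = J' i) -> reducible_sum J m = reducible_sum J' m.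
Proof.
move=> JJ; rewrite !reducible_sum_bounded; congr Posz; apply: eq_bigr => a _.
by apply: eq_bigr => i _; rewrite JJ //; case/andP: (valP i).
Qed.

End Recursion.

Theorem mainTheorem8 (F : finFieldType) (k : nat) (k_gt0 : (0 < k)%N) :
  [/\ forall m : 'X_{1..k}, (0 < m)%MM ->
        (Ik F m)%:Z = (Nk F m)%:Z - reducible_sum (@Ik F k) m,
      Ik F (0%MM : 'X_{1..k}) = 0%N
    & forall J : 'X_{1..k} -> nat,
        J 0%MM = 0%N ->
        (forall m : 'X_{1..k}, (0 < m)%MM ->
           (J m)%:Z = (Nk F m)%:Z - reducible_sum J m) ->
        forall m : 'X_{1..k}, J m = Ik F m].
Proof.
have rec (m : 'X_{1..k}) : (0 < m)%MM ->
    (Ik F m)%:Z = (Nk F m)%:Z - reducible_sum (@Ik F k) m.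
  move=> m0; rewrite reducible_sum_bounded -card_monic_reducible // Nk_monic.
  by rewrite PoszD addrK.
split=> //; first exact: Ik0.
(* Strong induction on the total degree, which drops strictly along i < m. *)
move=> J J0 Jrec m; have [n le] := ubnP (mdeg m); elim: n m le => // n IH m le.
have [->|m0] := eqVneq m 0%MM; first by rewrite J0 Ik0.
have m_gt0 : (0 < m)%MM.
  by apply/andP; split; [rewrite eq_sym|apply/mnm_lepP => i; rewrite mnm0E].
apply/eqP; rewrite -eqz_nat Jrec // rec //; apply/eqP; congr (_ - _).
apply: eq_reducible_sum => i im; apply: IH.
exact: leq_trans (ltm_mdeg im) _.
Qed.
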